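(* Let $G=(V,E)$ be a distance-transitive graph with $V=\{1,\dots,n\}$. Then the spectral realizations of $G$ are exactly the irreducible distance-transitive realizations of $G$; that is, a realization $v$ of $G$ is spectral if and only if it is an irreducible $\Sigma$-realization for some distance-transitive group $\Sigma\subseteq\mathrm{Aut}(G)$.
   Context: $G$ is a finite simple undirected connected graph with adjacency matrix $A$; $N(i)$ is the neighbourhood of $i$; $\mathrm{dist}(i,j)$ is the graph distance. A group $\Sigma\subseteq\mathrm{Aut}(G)$ is distance-transitive if for each $\delta\in\{0,\dots,\mathrm{diam}(G)\}$ it acts transitively on $\{(i,j)\in V\times V:\mathrm{dist}(i,j)=\delta\}$; $G$ is distance-transitive if $\mathrm{Aut}(G)$ is. A realization is a map $v\colon V\to\mathbb{R}^d$, assumed full-dimensional (the $v_i$ span $\mathbb{R}^d$); its arrangement matrix $M\in\mathbb{R}^{n\times d}$ has rows $v_i^\top$. It is a $\Sigma$-realization if there is a group homomorphism $T\colon\Sigma\to\mathrm{O}(\mathbb{R}^d)$ with $T_\sigma v_i=v_{\sigma(i)}$ for all $i,\sigma$; irreducible if $T$ has no invariant subspaces other than $\{0\}$ and $\mathbb{R}^d$; a distance-transitive realization is a $\Sigma$-realization for some distance-transitive $\Sigma$. $v$ is $\theta$-spectral (spectral) if $\sum_{j\in N(i)}v_j=\theta v_i$ for all $i$ and $d$ equals the multiplicity of $\theta$ as an eigenvalue of $A$. Convention of the paper: balanced and spectral realizations are assumed to be spherical, i.e. $M^\top M=\alpha I_d$ for some $\alpha>0$. *)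

(* Defs.v *)
From HB Require Import structures.
From mathcomp Require Import all_boot all_order all_fingroup all_algebra.
From mathcomp Require Import all_character.
From mathcomp Require Import reals.

Set Implicit Arguments.
Unset Strict Implicit.
Unset Printing Implicit Defensive.

Import GroupScope GRing.Theory.
Local Open Scope ring_scope.

Section Graph.
Variables (n : nat) (e : rel 'I_n).

Definition simple_graph : Prop := symmetric e /\ irreflexive e.

Definition connected_graph : Prop := forall i j : 'I_n, connect e i j.

Definition walk (k : nat) (i j : 'I_n) : bool :=
  [exists p : k.-tuple 'I_n, path e i p && (last i p == j)].

(* The least k < n such that some walk of length k joins i to j. In a connected
   graph such a k always exists; otherwise the value is n. *)
Definition dist (i j : 'I_n) : nat := find (fun k => walk k i j) (iota 0 n).

Definition diam : nat := (\max_(i < n) \max_(j < n) dist i j)%N.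

Definition graph_aut : {set {perm 'I_n}} :=
  [set s : {perm 'I_n} | [forall i, forall j, e (s i) (s j) == e i j]].

Lemma graph_aut_group_set : group_set graph_aut.
Proof.
apply/group_setP; split=> [|s t].
  by rewrite inE; apply/forallP=> i; apply/forallP=> j; rewrite !perm1.
rewrite !inE => /forallP hs /forallP ht.
apply/forallP=> i; apply/forallP=> j; rewrite !permM.
by rewrite (eqP (forallP (ht _) _)); apply: (forallP (hs i)).
Qed.

Canonical graph_aut_group : {group {perm 'I_n}} := Group graph_aut_group_set.

Definition distance_transitive (Sigma : {group {perm 'I_n}}) : Prop :=
  forall delta : nat, (delta <= diam)%N ->
  forall i j i' j' : 'I_n, dist i j = delta -> dist i' j' = delta ->
  exists2 s : {perm 'I_n}, s \in Sigma & s i = i' /\ s j = j'.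

Definition distance_transitive_graph : Prop :=
  distance_transitive graph_aut_group.

End Graph.

Section Realization.
Variables (R : realType) (n d : nat).
Implicit Types (e : rel 'I_n) (v : 'I_n -> 'rV[R]_d).
Implicit Types (Sigma : {group {perm 'I_n}}).

Definition adjacency e : 'M[R]_n := \matrix_(i, j) (e i j)%:R.

Definition arrangement v : 'M[R]_(n, d) := \matrix_(i < n) v i.

Definition full_dimensional v : Prop := row_full (arrangement v).

Definition spherical v : Prop :=
  exists2 alpha : R, 0 < alpha & (arrangement v)^T *m arrangement v = alpha%:M.

Definition balanced e (theta : R) v : Prop :=
  forall i : 'I_n, \sum_(j < n | e i j) v j = theta *: v i.

(* adjacency e is symmetric, so the multiplicity of theta is the dimension of
   its eigenspace. *)
Definition theta_spectral e (theta : R) v : Prop :=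
  [/\ eigenvalue (adjacency e) theta,
      balanced e theta v,
      d = \rank (eigenspace (adjacency e) theta) &
      spherical v].

Definition spectral e v : Prop := exists theta : R, theta_spectral e theta v.

Definition orthogonal_mx (Q : 'M[R]_d) : Prop := Q *m Q^T = 1%:M.

(* Points are row vectors, acted upon from the right: T s is the transpose of
   the orthogonal map of column vectors attached to s. Since (s * t) i = t (s i)
   for permutations, T is a morphism exactly when the family of transposes is
   one for the composition of maps. *)
Definition realizes Sigma v (T : mx_representation R Sigma d) : Prop :=
  (forall s, s \in Sigma -> orthogonal_mx (T s)) /\
  (forall s i, s \in Sigma -> v i *m T s = v (s i)).

Definition sigma_realization Sigma v : Prop :=
  exists T : mx_representation R Sigma d, realizes v T.

(* T is determined by v as soon as v is full-dimensional. *)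
Definition irreducible_sigma_realization Sigma v : Prop :=
  exists2 T : mx_representation R Sigma d, realizes v T & mx_irreducible T.

Definition irreducible_distance_transitive_realization e v : Prop :=
  exists Sigma : {group {perm 'I_n}},
    [/\ Sigma \subset graph_aut e,
        distance_transitive e Sigma &
        irreducible_sigma_realization Sigma v].

End Realization.

(* Main.v *)
Require Import Defs.
From HB Require Import structures.
From mathcomp Require Import all_boot all_order all_fingroup all_algebra.
From mathcomp Require Import all_character.
From mathcomp Require Import reals.
From mathcomp Require Import complex.

(** Let A be the adjacency matrix, M the arrangement matrix of v and P_s the
permutation matrix of s. If Sigma is distance-transitive, a matrix commuting
with all P_s depends only on the distance, and is therefore a polynomial in A.

If v is spectral, the columns of M span an eigenspace of A, on which Aut(G) acts
orthogonally; a matrix Q commuting with this action yields the polynomial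
M Q M^T in A, which is scalar on the eigenspace, so that Q is scalar and the
action is irreducible. Conversely, for an irreducible realization the symmetric
matrix M^T M is scalar by Schur's lemma. As M M^T is a polynomial p(A), the
column space of M is stable under A, and Schur's lemma applied to M^T A M shows
that it lies in an eigenspace of A; it is all of it because p(A) is scalar
there. *)

Set Implicit Arguments.
Unset Strict Implicit.
Unset Printing Implicit Defensive.

Import GroupScope Order.TTheory GRing.Theory Num.Theory.
Local Open Scope ring_scope.

(** * Walks and distances *)

Section Walks.
Variables (n : nat) (e : rel 'I_n).

Lemma walk0 i j : walk e 0 i j = (i == j).
Proof.
apply/existsP/eqP => [[p]|->]; first by rewrite tuple0 /= => /eqP.
by exists [tuple]; rewrite /= eqxx.
Qed.

Lemma walkS k i j : walk e k.+1 i j = [exists l, e i l && walk e k l j].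
Proof.
apply/existsP/existsP => [[p]|[l /andP[il /existsP[p lj]]]].
  case/tupleP: p => l p /= /andP[/andP[il lp] pj].
  by exists l; rewrite il; apply/existsP; exists p; rewrite lp.
by exists [tuple of l :: p]; rewrite /= il.
Qed.

Lemma walk_lt_dist k i j : (k < dist e i j)%N -> walk e k i j = false.
Proof.
move=> k_lt; have k_ltn : (k < n)%N.
  by apply: leq_trans k_lt _; rewrite -[leqRHS](size_iota 0); apply: find_size.
by have := before_find 0%N k_lt; rewrite nth_iota.
Qed.

(** A path shortens to one with distinct vertices, hence with fewer than [n] edges, so the search
    over [iota 0 n] in [dist] succeeds. *)
Lemma walk_dist i j : connect e i j -> walk e (dist e i j) i j.
Proof.
case/connectP=> p /shortenP[q path_q uniq_q _] ->.
have q_ltn : (size q < n)%N.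
  by have := max_card (mem (i :: q)); rewrite (card_uniqP uniq_q) card_ord.
have walks : has (fun k => walk e k i (last i q)) (iota 0 n).
  apply/hasP; exists (size q); first by rewrite mem_iota.
  by apply/existsP; exists (in_tuple q); rewrite path_q /=.
have := nth_find 0%N walks; rewrite nth_iota //.
by rewrite -[ltnRHS](size_iota 0) -has_find.
Qed.

Lemma dist_le_diam i j : (dist e i j <= diam e)%N.
Proof.
by apply: leq_trans (leq_bigmax i); apply: (leq_bigmax (F := dist e i)).
Qed.

End Walks.

(** * Invariant matrices and polynomials in the adjacency matrix *)

Section InvariantMatrices.
Variables (R : realType) (n : nat).
Implicit Types (e : rel 'I_n) (Sigma : {group {perm 'I_n}}) (B C : 'M[R]_n).

Definition invariant_mx Sigma B : Prop :=
  forall s i j, s \in Sigma -> B (s i) (s j) = B i j.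

Lemma perm_mx_commP (s : {perm 'I_n}) B :
  perm_mx s *m B = B *m perm_mx s <-> forall i j, B (s i) (s j) = B i j.
Proof.
rewrite -row_permE -[s in B *m perm_mx s]invgK -col_permE; split => [Bs i j|Bs].
  by have /matrixP/(_ i (s j)) := Bs; rewrite !mxE permK.
by apply/matrixP=> i j; rewrite !mxE -{1}(permKV s j) Bs.
Qed.

Lemma invariant_mxB Sigma B C (c : R) :
  invariant_mx Sigma B -> invariant_mx Sigma C -> invariant_mx Sigma (B - c *: C).
Proof. by move=> hB hC s i j hs; rewrite !mxE hB ?hC. Qed.

Lemma invariant_mxX Sigma B k :
  invariant_mx Sigma B -> invariant_mx Sigma (B ^+ k).
Proof.
move=> hB s i j hs; elim: k i j => [|k IH] i j.
  by rewrite expr0 !mxE (inj_eq perm_inj).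
rewrite exprS !mxE (reindex_inj (@perm_inj _ s)) /=.
by apply: eq_bigr => l _; rewrite hB // IH.
Qed.

Lemma adjacency_aut e Sigma : Sigma \subset graph_aut e ->
  invariant_mx Sigma (adjacency R e).
Proof.
move=> sSA s i j /(subsetP sSA); rewrite inE !mxE => /forallP/(_ i)/forallP/(_ j).
by move/eqP->.
Qed.

Lemma adjacency_sym e : symmetric e -> (adjacency R e)^T = adjacency R e.
Proof. by move=> esym; apply/matrixP=> i j; rewrite !mxE esym. Qed.

(** All terms of the sum for the next power are nonnegative, so none cancel; this is why sign and
    support go through one induction. *)
Lemma adjacencyX_walk e k i j :
  0 <= (adjacency R e ^+ k) i j /\ ((adjacency R e ^+ k) i j != 0) = walk e k i j.
Proof.
elim: k i j => [|k IH] i j.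
  by rewrite expr0 walk0 mxE; case: eqP; rewrite ?ler01 ?lexx ?oner_eq0 ?eqxx.
have ge0 l : 0 <= adjacency R e i l * (adjacency R e ^+ k) l j.
  by rewrite mulr_ge0 ?(IH _ _).1 // mxE ler0n.
rewrite exprS mxE walkS; split; first by apply: sumr_ge0.
rewrite psumr_eq0 // -has_predC; apply/hasP/existsP => -[l].
  move=> _ /=; rewrite mulf_eq0 negb_or (IH _ _).2 mxE pnatr_eq0 eqb0 negbK.
  by exists l.
move=> h; exists l; first by rewrite mem_index_enum.
by rewrite /= mulf_eq0 negb_or (IH _ _).2 mxE pnatr_eq0 eqb0 negbK.
Qed.

End InvariantMatrices.

(* If B vanishes at distances > m, subtracting the multiple of A^m that agrees
   with B at distance m leaves an invariant matrix vanishing at distances >= m,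
   since A^m has nonzero entries at distance m and none beyond. *)
Lemma invariant_mx_horner (R : realType) (n : nat) (e : rel 'I_n.+1)
    (Sigma : {group {perm 'I_n.+1}}) (B : 'M[R]_n.+1) :
    connected_graph e -> Sigma \subset graph_aut e ->
    distance_transitive e Sigma -> invariant_mx Sigma B ->
  exists p : {poly R}, B = horner_mx (adjacency R e) p.
Proof.
move=> econn sSA dtS; set A := adjacency R e.
have invA : invariant_mx Sigma A by apply: adjacency_aut.
suff main m (C : 'M[R]_n.+1) : invariant_mx Sigma C ->
    (forall i j, (m <= dist e i j)%N -> C i j = 0) ->
    exists p : {poly R}, C = horner_mx A p.
  (* On [n.+1] vertices [dist] never exceeds [n.+1], its default value included, so the vanishing
     condition at [n.+2] is vacuous. *)
  move=> invB; apply: (main n.+2) => // i j; rewrite ltnNge.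
  by rewrite -[leqRHS](size_iota 0) find_size.
elim: m C => [|m IH] C invC C0.
  by exists 0; rewrite rmorph0; apply/matrixP=> i j; rewrite C0 // mxE.
have [|] := boolP [exists i, exists j, dist e i j == m]; last first.
  move/existsPn=> nom; apply: IH => // i j; rewrite leq_eqVlt => /orP[|/C0//].
  by rewrite eq_sym => ijm; have /existsPn/(_ j) := nom i; rewrite ijm.
case/existsP=> i0 /existsP[j0 /eqP dm].
have [||p Dp] := IH (C - (C i0 j0 / (A ^+ m) i0 j0) *: A ^+ m).
- by apply: invariant_mxB => //; apply: invariant_mxX.
- move=> i j; rewrite mxE [X in _ + X]mxE [X in _ - X]mxE.
  rewrite leq_eqVlt => /orP[/eqP dij|lt_m]; last first.
    rewrite (C0 i j) //; have := (adjacencyX_walk R e m i j).2.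
    by rewrite walk_lt_dist // => /negbFE/eqP->; rewrite mulr0 subr0.
  have [|s sS [<- <-]] := dtS m _ _ _ _ _ dm (esym dij).
    by rewrite -dm dist_le_diam.
  have invX := invariant_mxX m invA.
  rewrite invC // invX // divfK ?subrr //.
  by rewrite (adjacencyX_walk R e m i0 j0).2 -dm walk_dist.
exists (p + (C i0 j0 / (A ^+ m) i0 j0) *: 'X^m).
by rewrite rmorphD /= linearZ /= rmorphXn /= horner_mx_X -Dp subrK.
Qed.

Lemma horner_mx_eigen (R : comNzRingType) (n d : nat) (A : 'M[R]_n.+1)
    (X : 'M[R]_(n.+1, d)) (theta : R) (p : {poly R}) :
  A *m X = theta *: X -> horner_mx A p *m X = p.[theta] *: X.
Proof.
move=> AX; elim/poly_ind: p => [|p c IH].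
  by rewrite rmorph0 horner0 mul0mx scale0r.
rewrite rmorphD rmorphM /= horner_mx_X horner_mx_C hornerMXaddC mulmxDl.
by rewrite -mulmxE -mulmxA AX -scalemxAr IH scalerA mul_scalar_mx scalerDl mulrC.
Qed.

(** * Real symmetric matrices and Schur's lemma *)

Section SymmetricMatrices.
Variable R : rcfType.

Lemma dotmx_ge0 n (u : 'rV[R]_n) : 0 <= (u *m u^T) 0 0.
Proof. by rewrite mxE sumr_ge0 // => i _; rewrite mxE -expr2 sqr_ge0. Qed.

Lemma dotmx_eq0 n (u : 'rV[R]_n) : ((u *m u^T) 0 0 == 0) = (u == 0).
Proof.
apply/eqP/eqP => [|->]; last by rewrite mul0mx mxE.
rewrite mxE => /eqP; rewrite psumr_eq0 => [/allP u0|i _]; last first.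
  by rewrite mxE -expr2 sqr_ge0.
apply/rowP=> i; have := u0 i (mem_index_enum _).
by rewrite !mxE -expr2 sqrf_eq0 => /eqP.
Qed.

(* A complex root a + ib of the characteristic polynomial makes the real matrix
   (S - a)^2 + b^2 singular; for u in its kernel,
   |u (S - a)|^2 + b^2 |u|^2 = 0. *)
Lemma symmetric_eigenvalue n (S : 'M[R]_n.+1) :
  S^T = S -> exists a : R, eigenvalue S a.
Proof.
move=> symS; pose f : {rmorphism R -> R[i]%C} := real_complex R.
have [z rootz] : exists z, root (char_poly (map_mx f S)) z.
  by apply/closed_rootP; rewrite size_char_poly.
pose a := complex.Re z; pose b := complex.Im z.
have /eigenvalueP[x xS x0] : eigenvalue (map_mx f S) z.
  by rewrite eigenvalue_root_char.
pose Sa := S - a%:M.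
have symSa : Sa^T = Sa by rewrite linearB /= symS tr_scalar_mx.
have /eqP/det0P[u u0 uS] : \det (Sa *m Sa + (b ^+ 2)%:M) = 0.
  apply/eqP; rewrite -(fmorph_eq0 f) -det_map_mx; apply/det0P; exists x => //.
  rewrite map_mxD map_mxM map_scalar_mx /= map_mxB map_scalar_mx /=.
  rewrite mulmxDr mulmxA.
  have xSa : x *m (map_mx f S - (f a)%:M) = (z - f a) *: x.
    by rewrite mulmxBr xS mul_mx_scalar scalerBl.
  rewrite xSa -scalemxAl xSa mul_mx_scalar scalerA -scalerDl.
  have -> : z - f a = 'i%C * f b by rewrite [in LHS](complexE z) addrC addKr.
  by rewrite -expr2 exprMn sqr_i mulN1r rmorphXn /= addNr scale0r.
exists a; apply/eigenvalueP; exists u => //.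
apply/eqP; rewrite -subr_eq0 -mul_mx_scalar -mulmxBr -/Sa -dotmx_eq0.
have := congr1 (fun X => (X *m u^T) 0 0) uS.
rewrite mul0mx mulmxDr mulmxDl mul_mx_scalar -scalemxAl mulmxA -[_ *m Sa *m _]mulmxA.
rewrite -{2}symSa -trmx_mul mxE [X in _ + X = _]mxE [RHS]mxE => /eqP.
by rewrite paddr_eq0 ?dotmx_ge0 ?(mulr_ge0 (sqr_ge0 b)) ?dotmx_ge0 // => /andP[].
Qed.

(** Over a real closed field, Schur's lemma only makes nonzero elements of the commutant invertible.
    Symmetry supplies an eigenvalue a in the field; S - a is then singular and in the commutant,
    hence zero. *)
Lemma symmetric_Schur (gT : finGroupType) (G : {group gT}) d
    (T : mx_representation R G d) (S : 'M[R]_d) :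
  mx_irreducible T -> S^T = S -> centgmx T S -> exists a : R, S = a%:M.
Proof.
move=> irrT; have /mx_irrP[d_gt0 _] := irrT.
case: d d_gt0 T irrT S => // d _ T irrT S symS cST.
have [a /eigenvalueP[u uS u0]] := symmetric_eigenvalue symS.
exists a; apply/eqP; rewrite -subr_eq0; apply: contraNT u0 => Sa_neq0.
have cSaT : centgmx T (S - a%:M).
  apply/centgmxP => s /(centgmxP cST) Ss.
  by rewrite mulmxBl mulmxBr Ss scalar_mxC.
have Sa_unit := mx_Schur irrT cSaT Sa_neq0.
apply/eqP; rewrite -(mulmxK Sa_unit u) mulmxBr uS mul_mx_scalar subrr.
by rewrite mul0mx.
Qed.

End SymmetricMatrices.

(** * Matrix forms of balance, realization and eigenspaces *)

Lemma mulmx_arrangement (R : realType) (n d : nat) (v : 'I_n -> 'rV[R]_d)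
    (B : 'M[R]_n) i : row i (B *m arrangement v) = \sum_j B i j *: v j.
Proof.
by rewrite row_mul mulmx_sum_row; apply: eq_bigr => j _; rewrite rowK mxE.
Qed.

Lemma balancedP (R : realType) (n d : nat) (e : rel 'I_n) (theta : R)
    (v : 'I_n -> 'rV[R]_d) :
  balanced e theta v <->
  adjacency R e *m arrangement v = theta *: arrangement v.
Proof.
have rowA i : row i (adjacency R e *m arrangement v) = \sum_(j < n | e i j) v j.
  rewrite mulmx_arrangement [RHS]big_mkcond /=; apply: eq_bigr => j _.
  by rewrite mxE; case: (e i j); rewrite ?scale1r ?scale0r.
split=> [bal|AM i]; last by rewrite -rowA AM linearZ /= rowK.
by apply/row_matrixP=> i; rewrite rowA bal linearZ /= rowK.
Qed.

Lemma realizesP (R : realType) (n d : nat) (v : 'I_n -> 'rV[R]_d)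
    (s : {perm 'I_n}) (Q : 'M[R]_d) :
  perm_mx s *m arrangement v = arrangement v *m Q <->
  forall i, v i *m Q = v (s i).
Proof.
rewrite -row_permE; split=> [PM i|vQ].
  by rewrite -[v i](rowK v) -row_mul -PM row_permEsub row_rowsub rowK.
apply/row_matrixP=> i; rewrite row_mul rowK vQ.
by apply/rowP=> j; rewrite !mxE.
Qed.

(** [eigenspace] consists of row vectors, whereas arrangement matrices carry eigenvectors in their
    columns; symmetry of [A] reconciles the two. *)
Lemma eigenspace_trP (F : fieldType) (n m : nat) (A : 'M[F]_n) (a : F)
    (X : 'M[F]_(n, m)) :
  A^T = A -> reflect (A *m X = a *: X) (X^T <= eigenspace A a)%MS.
Proof.
move=> symA; apply: (iffP eigenspaceP) => AX.
  by apply: trmx_inj; rewrite trmx_mul symA AX linearZ.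
by rewrite -linearZ /= -AX trmx_mul symA.
Qed.

Section DistanceTransitive.
Variables (R : realType) (n d : nat) (e : rel 'I_n.+1).
Variables (v : 'I_n.+1 -> 'rV[R]_d).
Hypotheses (e_sym : symmetric e) (e_connected : connected_graph e).
Hypothesis (v_full : full_dimensional v).

Let A := adjacency R e.
Let M := arrangement v.

Let symA : A^T = A. Proof. exact: adjacency_sym. Qed.

Lemma arrangement_inj p : injective (mulmx M : 'M_(d, p) -> 'M_(n.+1, p)).
Proof. exact: row_full_inj. Qed.

(** * The orthogonal action of the automorphisms on an eigenspace *)

Section Spectral.
Variables (theta alpha : R).
Hypotheses (alpha_gt0 : 0 < alpha) (MM : M^T *m M = alpha%:M).
Hypotheses (AM : A *m M = theta *: M).
Hypothesis dE : d = \rank (eigenspace A theta).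

Let alpha_neq0 : alpha != 0. Proof. by rewrite gt_eqF. Qed.

(* By dimension, the columns of M span the eigenspace, on which
   alpha^-1 M M^T is the orthogonal projection. *)
Lemma spectral_projection m (X : 'M[R]_(n.+1, m)) :
  A *m X = theta *: X -> M *m (alpha^-1 *: (M^T *m X)) = X.
Proof.
move/(eigenspace_trP _ _ symA) => XE.
have ME : (M^T <= eigenspace A theta)%MS by apply/eigenspace_trP.
have /submxP[D XD] : (X^T <= M^T)%MS.
  apply: submx_trans XE _; rewrite -(mxrank_leqif_sup ME).2 -dE mxrank_tr.
  exact: v_full.
have {XD} -> : X = M *m D^T by apply: trmx_inj; rewrite XD trmx_mul trmxK.
by rewrite [M^T *m _]mulmxA MM mul_scalar_mx scalerA mulVf // scale1r.
Qed.

(** For an automorphism s, the solution Q of M Q = P_s M: the action of P_s on the eigenspace, in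
    the basis given by the columns of M. *)
Definition spectral_action (s : {perm 'I_n.+1}) : 'M[R]_d :=
  alpha^-1 *: (M^T *m (perm_mx s *m M)).

Lemma spectral_actionE s :
  s \in graph_aut e -> M *m spectral_action s = perm_mx s *m M.
Proof.
move=> sA; apply: spectral_projection.
have /perm_mx_commP Ps : forall i j, A (s i) (s j) = A i j.
  by move=> i j; apply: (adjacency_aut R (subxx (graph_aut e))).
by rewrite mulmxA -Ps -mulmxA AM scalemxAr.
Qed.

Lemma spectral_action_repr : mx_repr (graph_aut e) spectral_action.
Proof.
split=> [|s t sA tA]; apply: arrangement_inj.
  by rewrite spectral_actionE ?group1 // perm_mx1 mul1mx mulmx1.
rewrite spectral_actionE ?groupM // mulmxA spectral_actionE // -mulmxA.
by rewrite spectral_actionE // perm_mxM mulmxA.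
Qed.

Definition spectral_repr : mx_representation R (graph_aut e) d :=
  MxRepresentation spectral_action_repr.

Lemma spectral_repr_realizes : realizes v spectral_repr.
Proof.
split=> s; last by move=> i sA; move: i; apply/realizesP; rewrite spectral_actionE.
move=> sA; apply: mulmx1C => /=.
have TM : (spectral_action s)^T *m M^T = M^T *m (perm_mx s)^T.
  by rewrite -!trmx_mul spectral_actionE.
(* Only the second factor is unfolded, so that the transpose of [perm_mx s] meets [perm_mx s] and
   cancels. *)
rewrite [X in _ *m X = _]/spectral_action -scalemxAr !mulmxA TM -!mulmxA.
rewrite [_^T *m (perm_mx s *m M)]mulmxA tr_perm_mx -perm_mxM mulVg perm_mx1.
by rewrite mul1mx MM scale_scalar_mx mulVf.
Qed.

End Spectral.

(** * Irreducible realizations *)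

Lemma realizes_perm (Sigma : {group {perm 'I_n.+1}})
    (T : mx_representation R Sigma d) s : realizes v T -> s \in Sigma ->
  perm_mx s *m M = M *m T s /\ M^T *m perm_mx s = T s *m M^T.
Proof.
move=> [orthT vT] sS.
have PM : perm_mx s *m M = M *m T s by apply/realizesP => i; apply: vT.
(* Transpose the first identity, then cancel [T s] and [perm_mx s] by orthogonality. *)
split=> //; have := congr1 (fun X => T s *m X *m perm_mx s) (congr1 trmx PM).
rewrite /= !trmx_mul !mulmxA orthT // mul1mx => <-.
by rewrite tr_perm_mx -!mulmxA -perm_mxM mulVg perm_mx1 mulmx1.
Qed.

(* For u in an invariant subspace U, Q := \sum_s (u T_s)^T (u T_s) commutes with
   T and has its rows in U. The invariant matrix M Q M^T is a polynomial in A,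
   hence scalar on the columns of M, so Q is a nonzero scalar. *)
Lemma eigen_realization_irr (Sigma : {group {perm 'I_n.+1}}) theta
    (T : mx_representation R Sigma d) :
    Sigma \subset graph_aut e -> distance_transitive e Sigma ->
    (0 < d)%N -> spherical v -> A *m M = theta *: M -> realizes v T ->
  mx_irreducible T.
Proof.
move=> sSA dtS d_gt0 [alpha alpha_gt0 MM] AM vT; have [orthT _] := vT.
apply/mx_irrP; split=> // U /mxmoduleP modU U_neq0.
have /rowV0Pn[u uU u_neq0] := U_neq0.
pose Q := \sum_(s in Sigma) (u *m T s)^T *m (u *m T s).
have QT t : t \in Sigma -> (T t)^T *m Q *m T t = Q.
  (* Right translation by t permutes the terms of the sum. *)
  move=> tS; rewrite mulmx_sumr mulmx_suml [RHS](reindex_acts 'R _ tS) /=; last first.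
    by rewrite astabsR.
  apply: eq_bigr => s sS; by rewrite repr_mxM // !trmx_mul !mulmxA.
have QU : (Q <= U)%MS.
  apply: summx_sub => s sS; apply: mulmx_sub.
  by apply: submx_trans (modU s sS); apply: submxMr.
have invB : invariant_mx Sigma (M *m Q *m M^T).
  move=> s i j sS; move: i j; apply/perm_mx_commP.
  have [PM MP] := realizes_perm vT sS.
  have TQ : T s *m Q = Q *m T s by rewrite -{1}(QT s sS) !mulmxA orthT ?mul1mx.
  by rewrite !mulmxA PM -[M *m T s *m Q]mulmxA TQ -!mulmxA MP.
have [p Bp] := invariant_mx_horner e_connected sSA dtS invB.
have := horner_mx_eigen p AM; rewrite -Bp -!mulmxA MM.
rewrite -[X in _ = _ *: X]mulmx1 scalemxAr => /arrangement_inj.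
rewrite mul_mx_scalar => Qp.
have Q_neq0 : Q != 0.
  (* The trace of Q is the sum of all |u T_s|^2, whose term at s = 1 is |u|^2. *)
  apply: contraNneq u_neq0 => /(congr1 mxtrace)/eqP; rewrite mxtrace0 raddf_sum /=.
  under eq_bigr do rewrite mxtrace_mulC trace_mx11.
  rewrite psumr_eq0 => [|s _]; last exact: dotmx_ge0.
  move/allP/(_ 1%g (mem_index_enum _)); rewrite group1 dotmx_eq0 repr_mx1.
  by rewrite mulmx1.
have alpha_neq0 : alpha != 0 by rewrite gt_eqF.
have p_neq0 : p.[theta] != 0.
  apply: contraNneq Q_neq0 => p0; move/eqP: Qp.
  by rewrite p0 scale0r scaler_eq0 (negPf alpha_neq0).
by rewrite -sub1mx -(eqmx_scale _ p_neq0) -Qp scalemx_sub.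
Qed.

Lemma irr_realization_spectral (Sigma : {group {perm 'I_n.+1}})
    (T : mx_representation R Sigma d) :
    Sigma \subset graph_aut e -> distance_transitive e Sigma ->
    realizes v T -> mx_irreducible T ->
  spectral e v.
Proof.
move=> sSA dtS vT irrT; have /mx_irrP[d_gt0 _] := irrT.
have M_neq0 : M != 0.
  by rewrite -mxrank_eq0 (eqP (v_full : \rank M == d)) -lt0n.
have [alpha MM] : exists alpha, M^T *m M = alpha%:M.
  apply: symmetric_Schur irrT _ _; first by rewrite trmx_mul trmxK.
  apply/centgmxP=> s sS; have [PM MP] := realizes_perm vT sS.
  by rewrite -mulmxA -PM mulmxA MP mulmxA.
have row_dot i : (row i M^T *m (row i M^T)^T) 0 0 = alpha.
  have /matrixP/(_ i i) := MM; rewrite [RHS]mxE eqxx mulr1n => <-.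
  by rewrite !mxE; apply: eq_bigr => j _; rewrite !mxE.
(* Every column of M has squared norm alpha, so alpha = 0 would force M = 0. *)
have alpha_gt0 : 0 < alpha.
  rewrite lt0r -{2}(row_dot (Ordinal d_gt0)) dotmx_ge0 andbT.
  apply: contraNneq M_neq0 => alpha0; rewrite -trmx_eq0; apply/eqP.
  by apply/row_matrixP=> i; apply/eqP; rewrite row0 -dotmx_eq0 row_dot alpha0.
have alpha_neq0 : alpha != 0 by rewrite gt_eqF.
have [p Bp] : exists p, M *m M^T = horner_mx A p.
  apply: invariant_mx_horner dtS _ => // s i j sS; move: i j.
  apply/perm_mx_commP; have [PM MP] := realizes_perm vT sS.
  by rewrite mulmxA PM -!mulmxA MP.
pose K := alpha^-1 *: (M^T *m A *m M).
(* M M^T = p(A) commutes with A, so M M^T A M = A M M^T M = alpha A M. *)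
have MK : M *m K = A *m M.
  rewrite -scalemxAr !mulmxA Bp [horner_mx A p *m A]comm_horner_mx //.
  rewrite -Bp -!mulmxA MM !mul_mx_scalar -scalemxAr scalerA mulVf //.
  by rewrite scale1r.
have [theta Ktheta] : exists theta, K = theta%:M.
  apply: symmetric_Schur irrT _ _.
    by rewrite linearZ /= !trmx_mul symA trmxK mulmxA.
  apply/centgmxP=> s sS; have [PM MP] := realizes_perm vT sS.
  have /perm_mx_commP PA : forall i j, A (s i) (s j) = A i j.
    by move=> i j; apply: (adjacency_aut R sSA).
  rewrite -scalemxAl -scalemxAr -!mulmxA -PM [A *m (_ *m _)]mulmxA -PA.
  by rewrite !mulmxA MP.
have AM : A *m M = theta *: M by rewrite -MK Ktheta mul_mx_scalar.
have p_theta : p.[theta] = alpha.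
  have /eqP := horner_mx_eigen p AM; rewrite -Bp -mulmxA MM mul_mx_scalar.
  rewrite -subr_eq0 -scalerBl scaler_eq0 (negPf M_neq0) orbF subr_eq0.
  by move/eqP.
have dE : d = \rank (eigenspace A theta).
  apply/eqP; rewrite -{1}(eqP (v_full : \rank M == d)) -mxrank_tr eqn_leq.
  rewrite mxrankS; last exact/eigenspace_trP.
  (* For eigenvectors X, alpha X = p(A) X = M (M^T X) lies in the column space of M. *)
  apply/mxrankS; have : (eigenspace A theta <= eigenspace A theta)%MS by [].
  rewrite -{1}[eigenspace A theta]trmxK => /(eigenspace_trP _ _ symA) AX.
  have := horner_mx_eigen p AX; rewrite -Bp p_theta => BX.
  rewrite -(eqmx_scale _ alpha_neq0).
  have -> : alpha *: eigenspace A theta = eigenspace A theta *m M *m M^T.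
    by apply: trmx_inj; rewrite linearZ /= -BX !trmx_mul trmxK mulmxA.
  exact: submxMl.
exists theta; split=> //; last by exists alpha.
  by rewrite /eigenvalue -mxrank_eq0 -lt0n -dE.
exact/balancedP.
Qed.

Lemma spectral_irr_realization :
    distance_transitive_graph e -> spectral e v ->
  irreducible_distance_transitive_realization e v.
Proof.
move=> e_dt [theta [eig_theta /balancedP AM dE sph_v]].
have [alpha alpha_gt0 MM] := sph_v.
exists (graph_aut_group e); split=> //.
have vT := spectral_repr_realizes alpha_gt0 MM AM dE.
exists (spectral_repr alpha_gt0 MM AM dE) => //.
by apply: (eigen_realization_irr _ e_dt _ sph_v AM vT); rewrite // dE lt0n mxrank_eq0.
Qed.

End DistanceTransitive.

Theorem theorem5p4 (R : realType) (n d : nat) (e : rel 'I_n)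
    (e_simple : simple_graph e) (e_connected : connected_graph e)
    (e_dt : distance_transitive_graph e)
    (v : 'I_n -> 'rV[R]_d) (v_full : full_dimensional v) :
  spectral e v <-> irreducible_distance_transitive_realization e v.
Proof.
case: e_simple => e_sym _; case: n => [|n] in e e_sym e_connected e_dt v v_full *.
  (* Without vertices both sides fail: there is no nonzero eigenvector, and full dimension forces d
     = 0 while irreducibility requires d > 0. *)
  split=> [[theta [/eigenvalueP[u _]]]|[Sigma [_ _ [T _ /mx_irrP[d_gt0 _]]]]].
    by rewrite thinmx0 eqxx.
  by have := v_full; rewrite /full_dimensional /row_full flatmx0 mxrank0 ltn_eqF.
split; first exact: spectral_irr_realization.
by case=> Sigma [sSA dtS [T vT irrT]]; apply: irr_realization_spectral vT irrT.
Qed.
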